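(* Let $U$ be a ground set with $|U| = n$, let $\mathcal{F} \subseteq 2^U$ be any family, and let $w^* \in \mathbb{Z}^U$ be an unknown integer weight function with $|w^*_e| \le B$ for all $e \in U$. Then one can sort the feasible sets $S \in \mathcal{F}$ according to their weight $w^*(S)$, and hence find $\arg\min_{S \in \mathcal{F}} w^*(S)$, using $O(nB \log (nB))$ comparison queries. More precisely, the number of comparison queries required is $O((n + C)\log C)$, where $C = |\{w^*(S) : S \in \mathcal{F}\}|$ is the number of distinct weight values realized by feasible sets.
   Context: $w^*(S) := \sum_{e \in S} w^*_e$. A comparison query takes $S, T \in \mathcal{F}$ and reveals whether $w^*(S) <, =, >$ $w^*(T)$. Only queries are counted, not computation time.
   Formalization: The logarithms are read as log max(2,C) and log max(2,nB), and B is taken to be at least 1: literally log C = 0 when C = 1, yet sorting n singletons of equal weight needs at least n-1 queries, and log(nB) is undefined for B = 0. *)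

(* Defs.v *)
From HB Require Import structures.
From mathcomp Require Import all_boot all_order all_algebra.
From mathcomp Require Import reals exp.

Set Implicit Arguments.
Unset Strict Implicit.
Unset Printing Implicit Defensive.

Import Order.TTheory GRing.Theory Num.Theory.
Local Open Scope ring_scope.

Definition weight (U : finType) (w : U -> int) (S : {set U}) : int :=
  \sum_(e in S) w e.

Definition num_values (U : finType) (F : {set {set U}}) (w : U -> int) : nat :=
  size (undup [seq weight w X | X in F]).

(* A deterministic adaptive algorithm is modelled by its decision tree. It may
   depend on U and F, but accesses the weights only through comparisons of two
   members of F; the subtrees [lt], [eq], [gt] are the continuations after the
   answers w(X) < w(Y), w(X) = w(Y), w(X) > w(Y). *)
Inductive query_tree (U : finType) (F : {set {set U}}) (A : Type) : Type :=
| Answer (a : A)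
| Compare (X Y : {Z : {set U} | Z \in F}) (lt eq gt : query_tree F A).

Fixpoint output (U : finType) (F : {set {set U}}) (A : Type)
    (w : U -> int) (t : query_tree F A) : A :=
  match t with
  | Answer a => a
  | Compare X Y lt eq gt =>
      if weight w (val X) < weight w (val Y) then output w lt
      else if weight w (val X) == weight w (val Y) then output w eq
      else output w gt
  end.

(* The number of comparisons made on the run determined by w. *)
Fixpoint num_queries (U : finType) (F : {set {set U}}) (A : Type)
    (w : U -> int) (t : query_tree F A) : nat :=
  match t with
  | Answer _ => 0%N
  | Compare X Y lt eq gt =>
      (if weight w (val X) < weight w (val Y) then num_queries w lt
       else if weight w (val X) == weight w (val Y) then num_queries w eq
       else num_queries w gt).+1
  end.

Definition sorts_by_weight (U : finType) (F : {set {set U}}) (w : U -> int)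
    (s : seq {set U}) : Prop :=
  perm_eq s (enum F) /\ sorted (fun X Y : {set U} => weight w X <= weight w Y) s.

Definition is_argmin (U : finType) (F : {set {set U}}) (w : U -> int)
    (S : {set U}) : Prop :=
  S \in F /\ forall T : {set U}, T \in F -> weight w S <= weight w T.

(* The logarithm inside the O-bounds, with the usual convention that arguments
   below 2 are replaced by 2: when C = 1 or n B = 1 a comparison may still be
   needed although ln 1 = 0. *)
Definition log_nat (R : realType) (m : nat) : R := ln (maxn 2 m)%:R.

(* The bounds O((n + C) log C) and O(n B log (n B)), with constant K, on the
   number q of queries made on w; B ranges over all positive bounds on the
   weights. *)
Definition query_bounds (R : realType) (K : R) (n : nat) (U : finType)
    (F : {set {set U}}) (w : U -> int) (q : nat) : Prop :=
  let C := num_values F w in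
  q%:R <= K * (n + C)%:R * log_nat R C /\
  forall B : nat, (0 < B)%N -> (forall e : U, `|w e| <= B%:Z) ->
    q%:R <= K * (n * B)%:R * log_nat R (n * B).

(* Main.v *)
(** Insert the members of [F] one by one, keeping a list [r] of representatives
    of the weight values met so far, sorted by weight, and a space [V] of
    vectors known to be orthogonal to the weights. A set [X] costs nothing if
    [1_X - 1_Y] lies in [V] for some [Y] in [r]. Otherwise binary search in [r]
    either finds a new value, so [r] grows, or finds [Y] in [r] of the same
    weight, and then [1_X - 1_Y] enlarges [V]. Hence there are at most
    [(C - 1) + n] searches, each with O(log C) queries. *)
Require Import Defs.
From HB Require Import structures.
From mathcomp Require Import all_boot all_order all_algebra.
From mathcomp Require Import reals exp.
From mathcomp Require Import zify lra.

Set Implicit Arguments.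
Unset Strict Implicit.
Unset Printing Implicit Defensive.

Import Order.TTheory GRing.Theory Num.Theory.
Local Open Scope ring_scope.

(** * Sequential composition of decision trees *)

Fixpoint tree_bind (U : finType) (F : {set {set U}}) (A A' : Type)
    (t : query_tree F A) (k : A -> query_tree F A') : query_tree F A' :=
  match t with
  | Answer a => k a
  | Compare X Y lt eq gt =>
      Compare X Y (tree_bind lt k) (tree_bind eq k) (tree_bind gt k)
  end.

Lemma output_bind (U : finType) (F : {set {set U}}) (A A' : Type)
    (w : U -> int) (t : query_tree F A) (k : A -> query_tree F A') :
  output w (tree_bind t k) = output w (k (output w t)).
Proof. by elim: t => //= X Y lt -> eq -> gt ->; case: ifP => // _; case: ifP. Qed.

Lemma num_queries_bind (U : finType) (F : {set {set U}}) (A A' : Type)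
    (w : U -> int) (t : query_tree F A) (k : A -> query_tree F A') :
  num_queries w (tree_bind t k) =
    (num_queries w t + num_queries w (k (output w t)))%N.
Proof.
elim: t => //= X Y lt -> eq -> gt ->; rewrite addSn.
by case: ifP => // _; case: ifP.
Qed.

(** * Indicator vectors and subspaces orthogonal to the weights *)

Section Indicator.
Variable U : finType.

(** Rational coefficients put the vectors in a space over a field, where a chain of strictly growing
    subspaces has length at most [#|U|]. *)
Definition indicator (S : {set U}) : 'rV[rat]_#|U| :=
  \row_i (enum_val i \in S)%:R.

Definition weight_col (w : U -> int) : 'cV[rat]_#|U| :=
  \col_i (w (enum_val i))%:~R.

Definition annihilates (w : U -> int) (V : {vspace 'rV[rat]_#|U|}) : Prop :=
  forall v, v \in V -> v *m weight_col w = 0.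

Lemma mul_indicator_weight (w : U -> int) (S : {set U}) :
  indicator S *m weight_col w = const_mx (weight w S)%:~R.
Proof.
apply/matrixP => i j; rewrite !mxE /weight rmorph_sum /=.
rewrite [RHS]big_mkcond (reindex (@enum_val U U)) /=; last first.
  by apply: onW_bij; apply: enum_val_bij.
apply: eq_bigr => k _; rewrite !mxE.
by case: (_ \in S); rewrite ?mul1r ?mul0r.
Qed.

Lemma mul_indicator_diff (w : U -> int) (S T : {set U}) :
  ((indicator S - indicator T) *m weight_col w == 0) =
    (weight w S == weight w T).
Proof.
rewrite mulmxBl !mul_indicator_weight subr_eq0.
apply/eqP/eqP => [/matrixP/(_ 0 0)|-> //].
by rewrite !mxE => /intr_inj.
Qed.

(** This replaces a query by linear algebra: membership in [V] is decided without access to [w]. *)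
Lemma annihilates_eq_weight (w : U -> int) (V : {vspace 'rV[rat]_#|U|})
    (S T : {set U}) :
  annihilates w V -> indicator S - indicator T \in V ->
  weight w S = weight w T.
Proof.
by move=> wV /wV/eqP; rewrite mul_indicator_diff => /eqP.
Qed.

Lemma annihilates0 (w : U -> int) : annihilates w 0%VS.
Proof. by move=> v; rewrite memv0 => /eqP->; rewrite mul0mx. Qed.

Lemma annihilates_add_line (w : U -> int) (V : {vspace 'rV[rat]_#|U|}) v :
  annihilates w V -> v *m weight_col w = 0 -> annihilates w (V + <[v]>).
Proof.
move=> wV wv _ /memv_addP[u uV [_ /vlineP[a ->] ->]].
by rewrite mulmxDl (wV _ uV) -scalemxAl wv scaler0 addr0.
Qed.

End Indicator.

Lemma dim_add_line (K : fieldType) (vT : vectType K) (V : {vspace vT}) v :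
  v \notin V -> (\dim V < \dim (V + <[v]>))%N.
Proof.
move=> vV; rewrite ltnNge; apply: contra vV => dimV.
have /eqP -> : V == (V + <[v]>)%VS by rewrite eqEdim addvSl.
exact: subvP (addvSr _ _) _ (memv_line v).
Qed.

(** * List facts behind binary search *)

Lemma sorted_insert (T : Type) (e : rel T) (x : T) (a b : seq T) :
  transitive e -> sorted e (a ++ b) -> all (e^~ x) a -> all (e x) b ->
  sorted e (a ++ x :: b).
Proof.
move=> tr; rewrite !(sorted_pairwise tr) !pairwise_cat /= allrel_consr.
by move=> /and3P[-> -> ->] -> ->.
Qed.

(** Removing the middle element leaves two halves that each fit the fuel [m], so one comparison
    lowers the fuel by one. *)
Lemma half_splitP (T : Type) (r : seq T) (m : nat) :
  (size r < 2 ^ m.+1)%N ->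
  match drop (size r)./2 r with
  | [::] => r = [::]
  | Y :: r' => [/\ r = take (size r)./2 r ++ Y :: r',
                  size (take (size r)./2 r) < 2 ^ m & size r' < 2 ^ m]%N
  end.
Proof.
have [r0|r_gt0] := posnP (size r); first by rewrite (size0nil r0).
have := size_drop (size r)./2 r; have := cat_take_drop (size r)./2 r.
rewrite expnS size_take.
case: (drop _ r) => [|Y r'] def_r /= sz lt_r; first lia.
split; [by rewrite def_r | by case: ifP; lia | lia].
Qed.

(** * Binary search among the representatives *)

Section Exploration.
Variables (U : finType) (F : {set {set U}}).

Local Notation feasible := {Z : {set U} | Z \in F}.
Local Notation vectors := 'rV[rat]_#|U|.

Definition lighter (w : U -> int) : rel feasible :=
  fun X Y => weight w (val X) < weight w (val Y).

Lemma lighter_trans w : transitive (lighter w).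
Proof. by move=> Y X Z; apply: lt_trans. Qed.

(* [a] and [b] accumulate the elements already known to be lighter and heavier
   than [X]; the answer is [inl] of an element of the same weight, or [inr] of
   the list with [X] inserted. The fuel [m] suffices when [size r < 2 ^ m]. *)
Fixpoint search (m : nat) (X : feasible) (a r b : seq feasible) :
    query_tree F (feasible + seq feasible) :=
  match m, drop (size r)./2 r with
  | m'.+1, Y :: r' =>
      Compare X Y (search m' X a (take (size r)./2 r) (Y :: r' ++ b))
        (Answer F (inl Y))
        (search m' X (a ++ take (size r)./2 r ++ [:: Y]) r' b)
  | _, _ => Answer F (inr (a ++ X :: b))
  end.

Lemma num_queries_search w m X a r b :
  (num_queries w (search m X a r b) <= m)%N.
Proof.
elim: m a r b => [|m IHm] a r b //=.
case: (drop _ r) => [|Y r'] //=; rewrite ltnS.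
by case: ifP => // _; case: ifP.
Qed.

Definition search_spec (w : U -> int) (X : feasible) (l : seq feasible)
    (o : feasible + seq feasible) : Prop :=
  match o with
  | inl Y => Y \in l /\ weight w (val X) = weight w (val Y)
  | inr l' => sorted (lighter w) l' /\ perm_eq l' (X :: l)
  end.

(** Recursive calls only move elements between the three lists, so [a ++ r ++ b] stays the original
    sorted list and induction on the fuel applies. *)
Lemma output_search w m X a r b :
  (size r < 2 ^ m)%N -> sorted (lighter w) (a ++ r ++ b) ->
  all ((lighter w)^~ X) a -> all (lighter w X) b ->
  search_spec w X (a ++ r ++ b) (output w (search m X a r b)).
Proof.
have tr := @lighter_trans w.
have insertP a' b' : sorted (lighter w) (a' ++ b') ->
    all ((lighter w)^~ X) a' -> all (lighter w X) b' ->
    search_spec w X (a' ++ b') (inr (a' ++ X :: b')).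
  move=> ? ? ?; split; first exact: sorted_insert.
  exact: (permEl (perm_catCA a' [:: X] b')).
elim: m a r b => [|m IHm] a r b /= szr srt aX Xb.
  by case: r szr srt => // _ srt; apply: insertP.
move: (take _ r) (drop _ r) (half_splitP szr) => r0 [|Y r'].
  by move=> r_nil; rewrite r_nil in srt *; apply: insertP.
move=> [def_r lt_r0 lt_r'].
rewrite {r szr}def_r -catA cat_cons in srt *.
(* Sortedness compares every other element with the pivot [Y]; transitivity then extends the outcome
   for [X] and [Y] to a whole side. *)
have [aY r0Y Yr' Yb] : [/\ all ((lighter w)^~ Y) a, all ((lighter w)^~ Y) r0,
    all (lighter w Y) r' & all (lighter w Y) b].
  move: srt; rewrite (sorted_pairwise tr) !pairwise_cat /= !allrel_catr.
  rewrite !allrel_consr all_cat => /and5P[/and3P[_ -> _] _ /andP[-> _] _].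
  by case/andP=> /andP[-> ->] _.
rewrite /=; case: ifP => [XY|XY].
  apply: IHm => //.
  rewrite /= all_cat Xb andbT; apply/andP; split=> //.
  by apply: sub_all Yr' => Z; apply: tr.
case: ifP => [/eqP eqXY|neqXY] /=.
  by split=> //; rewrite !mem_cat inE eqxx !orbT.
have YX : lighter w Y X by rewrite /lighter lt_neqAle eq_sym neqXY leNgt XY.
have -> : a ++ r0 ++ Y :: r' ++ b = (a ++ r0 ++ [:: Y]) ++ r' ++ b.
  by rewrite -!catA.
apply: IHm => //.
  by rewrite -!catA.
rewrite !all_cat aX /= YX !andbT.
by apply: sub_all r0Y => Z ZY; apply: tr ZY YX.
Qed.

(** * Exploration with amortized cost *)

Definition known (V : {vspace vectors}) (X Y : feasible) : bool :=
  indicator (val X) - indicator (val Y) \in V.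

(** For nonempty [r] this is the least [m] with [size r < 2 ^ m], hence just enough fuel for a
    search. *)
Definition depth (r : seq feasible) : nat := (trunc_log 2 (size r)).+1.

Fixpoint explore (s r : seq feasible) (V : {vspace vectors}) :
    query_tree F (seq feasible * {vspace vectors}) :=
  if s is X :: s' then
    if has (known V X) r then explore s' r V
    else tree_bind (search (depth r) X [::] r [::]) (fun o =>
      match o with
      | inl Y => explore s' r (V + <[indicator (val X) - indicator (val Y)]>)
      | inr r' => explore s' r' V
      end)
  else Answer F (r, V).

(* Potential argument: [p] stands for [size r + \dim V], which a search
   increases from [p] to [p1]. *)
Lemma search_cost_step (q q1 d d' p p1 p' : nat) :
  (q <= d)%N -> (d <= d')%N -> (p < p1)%N -> (q1 + d' * p1 <= d' * p')%N ->
  (q + q1 + d' * p <= d' * p')%N.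
Proof.
move=> le_q le_d lt_p; apply: leq_trans.
have : (d' * p.+1 <= d' * p1)%N by rewrite leq_mul2l lt_p orbT.
by rewrite mulnS; lia.
Qed.

(** In the cost field every search is charged at the depth of the final list, which is the largest,
    against the growth of [size r + \dim V]; the additive form avoids truncated subtraction. *)
Record explore_spec (w : U -> int) (s r : seq feasible)
    (V : {vspace vectors}) (r' : seq feasible) (V' : {vspace vectors})
    (q : nat) : Prop := ExploreSpec {
  explore_sorted : sorted (lighter w) r';
  explore_annihilates : annihilates w V';
  explore_subset : {subset r <= r'};
  explore_sub : (V <= V')%VS;
  explore_size : (size r <= size r')%N;
  explore_known : forall X, X \in s -> has (known V' X) r';
  explore_cost :
    (q + depth r' * (size r + \dim V) <= depth r' * (size r' + \dim V'))%N }.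

Lemma has_knownS (V V' : {vspace vectors}) (r r' : seq feasible) X :
  (V <= V')%VS -> {subset r <= r'} -> has (known V X) r -> has (known V' X) r'.
Proof.
move=> sVV' srr' /hasP[Y Yr kXY]; apply/hasP; exists Y; first exact: srr'.
exact: subvP sVV' _ kXY.
Qed.

Lemma exploreP w s r V :
  sorted (lighter w) r -> annihilates w V ->
  let o := output w (explore s r V) in
  explore_spec w s r V o.1 o.2 (num_queries w (explore s r V)).
Proof.
elim: s r V => [|X s IHs] r V srt wV /=; first by split.
case: ifPn => [kX|nkX].
  have [? ? srr' sVV' ? kn ?] := IHs r V srt wV; split=> // Z.
  by rewrite inE => /predU1P[->|/kn//]; apply: has_knownS kX.
rewrite output_bind num_queries_bind.
have := num_queries_search w (depth r) X [::] r [::].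
have : search_spec w X r (output w (search (depth r) X [::] r [::])).
  have := @output_search w (depth r) X [::] r [::]; rewrite cats0; apply=> //.
  exact: trunc_log_ltn.
have depthS r' : (size r <= size r')%N -> (depth r <= depth r')%N.
  by move=> ?; rewrite ltnS leq_trunc_log.
case: (output w _) => [Y [Yr eqXY]|r1 [srt1 perm1]];
  set q := num_queries w (search _ _ _ _ _) => le_q.
- set v := indicator (val X) - indicator (val Y).
  (* Otherwise [Y] would already make [X] known, and no search would have taken place. *)
  have vV : v \notin V by apply: contra nkX => vV; apply/hasP; exists Y.
  have wv : v *m weight_col w = 0.
    by apply/eqP; rewrite mul_indicator_diff eqXY.
  have [? ? srr' sVV' ler kn cost] :=
    IHs r _ srt (annihilates_add_line wV wv).
  split=> //.
  + exact: subv_trans (addvSl _ _) sVV'.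
  + move=> Z; rewrite inE => /predU1P[->|/kn//].
    apply: has_knownS sVV' srr' _; apply/hasP; exists Y => //.
    exact: subvP (addvSr _ _) _ (memv_line v).
  + apply: search_cost_step le_q (depthS _ ler) _ cost.
    by rewrite ltn_add2l dim_add_line.
- have [? ? srr' sVV' ler kn cost] := IHs r1 V srt1 wV.
  have sz1 : size r1 = (size r).+1 by rewrite (perm_size perm1).
  have ler' : (size r <= size (output w (explore s r1 V)).1)%N by lia.
  split=> //.
  + by move=> Z Zr; apply: srr'; rewrite (perm_mem perm1) inE Zr orbT.
  + move=> Z; rewrite inE => /predU1P[->|/kn//].
    (* The newly inserted [X] represents itself, as the zero vector lies in every subspace. *)
    apply/hasP; exists X; last by rewrite /known subrr mem0v.
    by apply: srr'; rewrite (perm_mem perm1) inE eqxx.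
  + by apply: search_cost_step le_q (depthS _ ler') _ cost; rewrite sz1.
Qed.

(** * Exploring the whole family and sorting from the result *)

Definition explore_all : query_tree F (seq feasible * {vspace vectors}) :=
  if enum {: feasible} is X :: s then explore s [:: X] 0%VS
  else Answer F ([::], 0%VS).

(** The first set enters the list without a query, which turns [size r] into its predecessor in the
    bound; the other summand bounds [\dim V] by the ambient dimension. *)
Lemma explore_allP w :
  let: (r, V) := output w explore_all in
  [/\ sorted (lighter w) r, annihilates w V,
      forall X, has (known V X) r
    & (num_queries w explore_all <= depth r * ((size r).-1 + #|U|))%N].
Proof.
rewrite /explore_all.
have mem_all (X : feasible) : X \in enum {: feasible} by rewrite mem_enum.
case: (enum _) mem_all => [|X s] mem_all /=.
  by split=> //; exact: annihilates0.
have := @exploreP w s [:: X] 0%VS isT (@annihilates0 _ w).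
case: (output w _) => r V /= [srt wV srr' sV ler kn cost]; split=> //.
  move=> Y; have := mem_all Y; rewrite inE => /predU1P[->|/kn//].
  by apply/hasP; exists X; rewrite ?srr' ?inE // /known subrr mem0v.
have : (\dim V <= #|U|)%N.
  by apply: leq_trans (dimvS (subvf V)) _; rewrite dimvf /dim /= mul1n.
by move: cost; rewrite dimv0 /=; nia.
Qed.

(** The position of the representative in the sorted list serves as sorting key, so this step makes
    no query. *)
Definition sort_by_class (rV : seq feasible * {vspace vectors}) : seq {set U} :=
  let class (X : feasible) := find (known rV.2 X) rV.1 in
  map val (sort (fun X Y => class X <= class Y)%N (enum {: feasible})).

Definition sorting_tree : query_tree F (seq {set U}) :=
  tree_bind explore_all (fun rV => Answer F (sort_by_class rV)).

Lemma num_queries_sorting w :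
  num_queries w sorting_tree = num_queries w explore_all.
Proof. by rewrite num_queries_bind /= addn0. Qed.

Lemma output_sorting w : sorts_by_weight F w (output w sorting_tree).
Proof.
rewrite output_bind /=; have := explore_allP w.
case: (output w _) => r V [srt wV kn _] /=; split.
  rewrite /sort_by_class /=; apply: uniq_perm.
  - by rewrite (map_inj_uniq val_inj) sort_uniq enum_uniq.
  - exact: enum_uniq.
  - move=> Z; rewrite mem_enum; apply/mapP/idP => [[X _ ->]|ZF].
      exact: (valP X).
    by exists (Sub Z ZF); rewrite ?SubK // mem_sort mem_enum.
rewrite /sort_by_class sorted_map.
pose class X := find (known V X) r.
apply: (@sub_sorted _ (fun X Y => class X <= class Y)%N); last first.
  by apply: sort_sorted => X Y; apply: leq_total.
  (* Equal positions give the same representative, hence equal weights; a smaller position gives a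
     strictly lighter representative. *)
  move=> X Y /=; rewrite leq_eqVlt.
  pose rep Z := nth X r (class Z).
  have wrep Z : weight w (val Z) = weight w (val (rep Z)).
    exact: annihilates_eq_weight wV (nth_find X (kn Z)).
  rewrite (wrep X) (wrep Y) /rep => /predU1P[->//|lt_class]; apply: ltW.
  by apply: (sorted_ltn_nth (@lighter_trans w) X srt) lt_class;
    rewrite inE -has_find kn.
Qed.

(** Strictly increasing weights are pairwise distinct values attained on [F]. *)
Lemma size_sorted_lighter w (r : seq feasible) :
  sorted (lighter w) r -> (size r <= num_values F w)%N.
Proof.
move=> srt; rewrite -(size_map (fun X => weight w (val X))).
apply: uniq_leq_size.
  apply: (@sorted_uniq _ <%O lt_trans ltxx).
  by rewrite sorted_map.
move=> _ /mapP[X _ ->]; rewrite mem_undup; apply: map_f.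
by rewrite mem_enum (valP X).
Qed.

Lemma num_queries_sorting_le w :
  (num_queries w sorting_tree <=
    (trunc_log 2 (num_values F w)).+1 * ((num_values F w).-1 + #|U|))%N.
Proof.
rewrite num_queries_sorting; have := explore_allP w.
case: (output w _) => r V [srt _ _ /leq_trans]; apply.
have := size_sorted_lighter srt.
move=> le_rC; apply: leq_mul; first by rewrite ltnS leq_trunc_log.
by rewrite leq_add2r; lia.
Qed.

End Exploration.

(** * Bounding the number of values by the weight bound *)

Lemma uniq_bounded_int_size (s : seq int) (N : nat) :
  uniq s -> (forall x, x \in s -> `|x| <= N%:Z) -> (size s <= N.*2.+1)%N.
Proof.
(* Adding [N] maps the interval from [-N] to [N] injectively into the naturals up to [2N]. *)
move=> s_uniq s_le.
pose shift (x : int) := absz (x + N%:Z).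
rewrite -(size_map shift) -(size_iota 0 N.*2.+1); apply: uniq_leq_size.
  rewrite map_inj_in_uniq // => x y /s_le + /s_le; rewrite /shift; lia.
by move=> _ /mapP[x /s_le + ->]; rewrite mem_iota /shift; lia.
Qed.

Lemma norm_weight_le (U : finType) (w : U -> int) (B : nat) (S : {set U}) :
  (forall e, `|w e| <= B%:Z) -> `|weight w S| <= (#|U| * B)%N%:Z.
Proof.
move=> wB; apply: le_trans (ler_norm_sum _ _ _) _.
apply: le_trans (ler_sum _ (fun e _ => wB e)) _.
rewrite sumr_const -mulr_natr natz -PoszM lez_nat mulnC leq_mul2r.
by rewrite max_card orbT.
Qed.

Lemma num_values_le (U : finType) (F : {set {set U}}) (w : U -> int) (B : nat) :
  (forall e, `|w e| <= B%:Z) -> (num_values F w <= (#|U| * B).*2.+1)%N.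
Proof.
move=> wB; apply: uniq_bounded_int_size (undup_uniq _) _ => x.
by rewrite mem_undup => /mapP[S _ ->]; apply: norm_weight_le.
Qed.

(** * From discrete logarithms to the stated bounds *)

Section LogBounds.
Variable R : realType.

Let ln2_gt0 : 0 < ln 2 :> R.
Proof. by rewrite ln_gt0 // ltr1n. Qed.

Lemma log_nat_ge0 (m : nat) : 0 <= log_nat R m.
Proof. by rewrite /log_nat ln_ge0 // ler1n; lia. Qed.

(** Replacing [m] by [maxn 2 m] makes the truncated logarithm at least 1, so the successor costs
    only a factor 2. *)
Lemma trunc_log_ln_le (m : nat) :
  (trunc_log 2 m).+1%:R <= 2 / ln 2 * log_nat R m.
Proof.
set M := maxn 2 m.
have M_gt0 : (0 < M)%N by rewrite /M; lia.
have le_log : (trunc_log 2 m <= trunc_log 2 M)%N.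
  by apply: leq_trunc_log; rewrite leq_maxr.
have log_gt0 : (0 < trunc_log 2 M)%N.
  by rewrite trunc_log_gt0 /M; lia.
have : (trunc_log 2 M)%:R * ln 2 <= log_nat R m.
  rewrite mulr_natl -lnXn ?ltr0n // ler_ln ?posrE ?exprn_gt0 ?ltr0n //.
  by rewrite -natrX ler_nat trunc_logP.
rewrite mulrAC ler_pdivlMr // => le_ln.
have : (trunc_log 2 m).+1%:R <= 2 * (trunc_log 2 M)%:R :> R.
  by rewrite -natrM ler_nat; lia.
move=> /(ler_wpM2r (ltW ln2_gt0)) /le_trans; apply.
by rewrite -mulrA ler_wpM2l.
Qed.

(** With [M = maxn 2 N], both 2 and [2N + 1] are at most [M ^ 3], whence the factor 3. *)
Lemma log_nat_affine_le (C N : nat) :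
  (0 < N)%N -> (C <= N.*2.+1)%N -> log_nat R C <= 3 * log_nat R N.
Proof.
move=> N_gt0 leCN.
have max_gt0 k : (maxn 2 k)%:R \is @Num.pos R by rewrite posrE ltr0n; lia.
rewrite /log_nat mulr_natl -lnXn -?posrE // ler_ln ?rpredX //.
rewrite -natrX ler_nat geq_max; apply/andP; split.
  by rewrite -[X in (X <= _)%N]expn1; apply: (@leq_trans (2 ^ 3)) => //;
    rewrite leq_exp2r // leq_maxl.
have : (N <= maxn 2 N)%N by rewrite leq_maxr.
have : (2 <= maxn 2 N)%N by rewrite leq_maxl.
by move: (maxn 2 N) => M; rewrite !expnS expn0; nia.
Qed.

(** The constant is 18 = 2 * 3 * 3: 2 from [trunc_log_ln_le], 3 from [C - 1 + n <= 3nB], and 3 from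
    [log_nat_affine_le]. *)
Lemma query_bounds_of_le (U : finType) (F : {set {set U}}) (w : U -> int) q :
  (q <= (trunc_log 2 (num_values F w)).+1 * ((num_values F w).-1 + #|U|))%N ->
  query_bounds (18 / ln 2 : R) #|U| F w q.
Proof.
rewrite /query_bounds -(ler_nat R) natrM; set C := num_values F w => le_q.
have log_C := trunc_log_ln_le C.
have log_C0 := log_nat_ge0 C.
have ln2V : 0 < (ln 2)^-1 :> R by rewrite invr_gt0.
split=> [|B B_gt0 wB].
  apply: le_trans le_q _.
  apply: le_trans (ler_wpM2r (ler0n _ _) log_C) _.
  have : (C.-1 + #|U|)%:R <= (#|U| + C)%:R :> R by rewrite ler_nat; lia.
  rewrite mulrAC => le_n.
  apply: ler_wpM2r => //; apply: ler_pM => //.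
    by rewrite mulr_ge0 ?ltW.
  by rewrite ler_wpM2r ?ltW // ltr_nat.
have := num_values_le F wB; rewrite -/C => leC.
(* For empty [U] the logarithm estimate does not apply, but then [C <= 1] and the bound on [q] is
   zero. *)
have [U0|U_gt0] := posnP #|U|.
  move: le_q; rewrite U0 mul0n in leC *.
  have -> : (C.-1 + 0 = 0)%N by lia.
  by rewrite mulr0 mulr0 mul0r.
have N_gt0 : (0 < #|U| * B)%N by rewrite muln_gt0 U_gt0.
(* Here [C - 1 <= 2nB], and [n <= nB] because [B] is positive. *)
have le_N : (C.-1 + #|U|)%:R <= (3 * (#|U| * B))%:R :> R.
  by rewrite ler_nat; nia.
have log_N := log_nat_affine_le N_gt0 leC.
apply: le_trans le_q _.
apply: le_trans (ler_pM (ler0n _ _) (ler0n _ _) log_C le_N) _.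
apply: le_trans (ler_wpM2r (ler0n _ _) (ler_wpM2l _ log_N)) _.
  by rewrite mulr_ge0 ?ltW.
rewrite natrM le_eqVlt; apply/orP; left; apply/eqP.
move: (ln 2)^-1 (log_nat R _) ((#|U| * B)%:R : R) => x y z; lra.
Qed.

End LogBounds.

(** * Minimizers, and the conclusion *)

Lemma is_argmin_head (U : finType) (F : {set {set U}}) (w : U -> int) s :
  F != set0 -> sorts_by_weight F w s -> is_argmin F w (head set0 s).
Proof.
move=> /set0Pn[S SF] [perm_s sorted_s].
have mem_s : s =i F by move=> T; rewrite (perm_mem perm_s) mem_enum.
(* Since [F] is nonempty the list is too, so [head] never falls back on its default. *)
case: s {perm_s} sorted_s mem_s => [|T s] /= sorted_s mem_s.
  by have := mem_s S; rewrite SF.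
split; first by rewrite -mem_s mem_head.
move=> T'; rewrite -mem_s inE => /predU1P[->//|T's].
have tr : transitive (fun X Y : {set U} => weight w X <= weight w Y).
  by move=> Y X Z; apply: le_trans.
by have /allP := order_path_min tr sorted_s; apply.
Qed.

Theorem mainTheorem3 (R : realType) :
  exists K : R, forall (n : nat) (U : finType) (F : {set {set U}}),
    #|U| = n ->
    (exists t : query_tree F (seq {set U}), forall w : U -> int,
       sorts_by_weight F w (output w t) /\
       query_bounds K n F w (num_queries w t)) /\
    (F != set0 ->
     exists t : query_tree F {set U}, forall w : U -> int,
       is_argmin F w (output w t) /\
       query_bounds K n F w (num_queries w t)).
Proof.
exists (18 / ln 2) => _ U F <-; split=> [|F0].
  exists (sorting_tree F) => w; split; first exact: output_sorting.
  exact/query_bounds_of_le/num_queries_sorting_le.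
(* Taking the head of the sorted list adds no query, so the same bound serves. *)
exists (tree_bind (sorting_tree F) (fun s => Answer F (head set0 s))) => w.
rewrite output_bind num_queries_bind /= addn0; split.
  exact: is_argmin_head F0 (output_sorting F w).
exact/query_bounds_of_le/num_queries_sorting_le.
Qed.
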